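(* Let $(X,f)$ be a quasi-continuous dynamical system, where $X$ is a perfect and Hausdorff space. Then the following implications hold for $(X,f)$: $$\mathrm{TT} \Longrightarrow \mathrm{TT}_{+} \Longrightarrow \mathrm{TT}_{++}.$$
   Context: $\mathbb N$ denotes the set of nonnegative integers. A dynamical system is a pair $(X,f)$ where $X$ is a topological space (with at least two points) and $f:X\to X$ is a map, not necessarily continuous. A map $g:X\to Y$ between topological spaces is quasi-continuous if for every $x_0\in X$, every open neighbourhood $W$ of $g(x_0)$ and every open neighbourhood $U$ of $x_0$, there is a nonempty open set $V\subseteq U$ with $g(V)\subseteq W$. The system $(X,f)$ is quasi-continuous if $f^n$ is quasi-continuous for every $n\in\mathbb N$. A space is perfect if it has no isolated points. For $A,B\subseteq X$, $N(A,B)=\{n\in\mathbb Z: f^n(A)\cap B\neq\emptyset\}$, where for $n<0$, $f^{n}(A)$ means the preimage $(f^{-n})^{-1}(A)$; and $N_+(A,B)=N(A,B)\cap\mathbb N$. TT: for every pair of nonempty open sets $U,V\subseteq X$, $N(U,V)\neq\emptyset$. TT$_+$: for every pair of nonempty open sets $U,V\subseteq X$, $N_+(U,V)\ne\emptyset$. TT$_{++}$: for every pair of nonempty open sets $U,V\subseteq X$, $N_+(U,V)$ is infinite. *)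

(* Defs.v *)
From HB Require Import structures.
From mathcomp Require Import all_boot all_order all_algebra.
From mathcomp Require Import all_classical.
From mathcomp Require Import topology.

Set Implicit Arguments.
Unset Strict Implicit.
Unset Printing Implicit Defensive.

Import Order.TTheory GRing.Theory Num.Theory.

Local Open Scope classical_set_scope.
Local Open Scope ring_scope.

Definition quasi_continuous (X Y : topologicalType) (g : X -> Y) : Prop :=
  forall (x0 : X) (W : set Y) (U : set X),
    open_nbhs (g x0) W -> open_nbhs x0 U ->
    exists V : set X, [/\ open V, V !=set0, V `<=` U & g @` V `<=` W].

Definition quasi_continuous_system (X : topologicalType) (f : X -> X) : Prop :=
  forall n : nat, quasi_continuous (iter n f).

(* f^n(A) for n : int; Negz k is the integer -(k+1), for which f^n(A) is the
   preimage of A under f^(k+1). *)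
Definition iter_image (X : Type) (f : X -> X) (n : int) (A : set X) : set X :=
  match n with
  | Posz k => iter k f @` A
  | Negz k => iter k.+1 f @^-1` A
  end.

Definition hitting_times (X : Type) (f : X -> X) (A B : set X) : set int :=
  [set n | iter_image f n A `&` B !=set0].

Definition hitting_times_plus (X : Type) (f : X -> X) (A B : set X) : set int :=
  hitting_times f A B `&` [set n | 0 <= n].

Definition TT (X : topologicalType) (f : X -> X) : Prop :=
  forall U V : set X, open U -> U !=set0 -> open V -> V !=set0 ->
    hitting_times f U V !=set0.

Definition TT_plus (X : topologicalType) (f : X -> X) : Prop :=
  forall U V : set X, open U -> U !=set0 -> open V -> V !=set0 ->
    hitting_times_plus f U V !=set0.

Definition TT_plus_plus (X : topologicalType) (f : X -> X) : Prop :=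
  forall U V : set X, open U -> U !=set0 -> open V -> V !=set0 ->
    infinite_set (hitting_times_plus f U V).

(* Main.v *)
Require Import Defs.
From HB Require Import structures.
From mathcomp Require Import all_boot all_order all_algebra.
From mathcomp Require Import all_classical.
From mathcomp Require Import topology.

Set Implicit Arguments.
Unset Strict Implicit.

(** Everything rests on recurrence: under TT each nonempty open [U] returns to
    itself at arbitrarily large times ([TT_return_unbounded]). A space that is
    perfect and Hausdorff gives two disjoint nonempty open subsets of [U];
    whichever direction TT provides for an orbit joining them, it is a return
    to [U] at a positive time. Quasi-continuity then replaces continuity: if
    some point of [U] lies in [V] after [n] steps, then a whole nonempty open
    part [U'] of [U] is sent into [V] by [f^n] ([quasi_continuous_shrink]).
    Taking [V = U] and returning to [U'] at a positive time adds up two return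
    times, so return times are unbounded.

    Recurrence yields both implications. If TT only gives an orbit from [V] to
    [U] of length [k], shrink [V] to [V'] with [f^k(V')] inside [U]; a return
    to [V'] at a time [n >= k] passes through [U] at time [k], hence leads from
    [U] to [V] in [n - k] steps. If TT_+ gives an orbit from [U] to [V] of
    length [k], shrink [U] to [U'] with [f^k(U')] inside [V]; arbitrarily late
    returns to [U'], followed by [k] more steps, hit [V] arbitrarily late. *)

Local Open Scope classical_set_scope.

(** If the elements of [A] formed a finite list, each would be bounded by the
    sum of the absolute values of the whole list. *)
Lemma infinite_set_int_unbounded (A : set int) :
  (forall m : nat, exists2 n : nat, m <= n & A (Posz n)) -> infinite_set A.
Proof.
move=> unboundedA /finite_seqP[s As].
have [n] := unboundedA (sumn (map absz s)).+1.
rewrite As /= => lt_sum_n /(map_f absz)/= s_n.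
move: lt_sum_n; rewrite ltnNge => /negP; apply.
by rewrite sumnE (big_rem _ s_n) leq_addr.
Qed.

Lemma hitting_times_plusP (X : Type) (f : X -> X) (A B : set X) (n : nat) :
  hitting_times_plus f A B (Posz n) <-> exists2 x, A x & B (iter n f x).
Proof.
split=> [[[y [[x Ax <-] Bfx]] _]|[x Ax Bfx]]; first by exists x.
by split=> //; exists (iter n f x); split=> //; exists x.
Qed.

(** A hit at a negative time [n] is a point of [B] that [absz n] forward steps
    send into [A]. This turns the preimages in TT
    into forward orbits, to which [quasi_continuous_shrink] applies. *)
Lemma hitting_times_orbit (X : Type) (f : X -> X) (A B : set X) (n : int) :
  hitting_times f A B n ->
  (exists2 x, A x & B (iter (absz n) f x)) \/
  (exists2 x, B x & A (iter (absz n) f x)).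
Proof.
case: n => [k [y [[x Ax <-] Bfx]]|k [y [Afy By]]]; first by left; exists x.
by right; exists y.
Qed.

Lemma disjoint_open_subsets (X : topologicalType) (U : set X) :
  hausdorff_space X -> isolated [set: X] = set0 -> open U -> U !=set0 ->
  exists A B : set X,
    [/\ open A /\ A !=set0, open B /\ B !=set0,
        A `<=` U, B `<=` U & A `&` B = set0].
Proof.
move=> X_hausdorff X_perfect openU [x Ux].
have [y Uy xDy] : exists2 y, U y & x != y.
  apply: contrapT => noy; suff: isolated [set: X] x by rewrite X_perfect.
  split; first by rewrite inE.
  exists U; first exact: open_nbhs_nbhs.
  rewrite setIT; apply/seteqP; split=> [z Uz|z ->//] /=.
  by apply: contrapT => /eqP zDx; apply: noy; exists z; rewrite // eq_sym.
move: X_hausdorff; rewrite open_hausdorff => /(_ x y xDy).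
move=> [[A B] /= [/set_mem Ax /set_mem By] [openA openB /eqP AB0]].
exists (U `&` A), (U `&` B); split.
- by split; [exact: openI | exists x].
- by split; [exact: openI | exists y].
- exact: subIsetl.
- exact: subIsetl.
- by rewrite setIACA AB0 setI0.
Qed.

(** The form in which quasi-continuity substitutes for the openness of
    [U `&` iter n f @^-1` V]: that set need not be open, but it contains a
    nonempty open set as soon as it is nonempty. *)
Lemma quasi_continuous_shrink (X : topologicalType) (f : X -> X)
    (U V : set X) (n : nat) (x : X) :
  quasi_continuous_system f -> open U -> open V -> U x -> V (iter n f x) ->
  exists U' : set X, [/\ open U', U' !=set0, U' `<=` U &
    forall z, U' z -> V (iter n f z)].
Proof.
move=> f_qc openU openV Ux Vfx.
have [U' [openU' U'0 U'U fU'V]] := f_qc n x V U (conj openV Vfx) (conj openU Ux).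
by exists U'; split=> // z U'z; apply: fU'V; exists z.
Qed.

Section Recurrence.
Context (X : topologicalType) (f : X -> X).
Hypotheses (f_qc : quasi_continuous_system f)
  (X_perfect : isolated [set: X] = set0) (X_hausdorff : hausdorff_space X).

(** The sets joined by TT are disjoint, which excludes the trivial time 0; both
    lie in [U], so the direction of the orbit does not matter. *)
Lemma TT_return_positive (U : set X) :
  TT f -> open U -> U !=set0 ->
  exists2 n : nat, 0 < n & exists2 x, U x & U (iter n f x).
Proof.
move=> f_TT openU U0.
have [A [B [[openA A0] [openB B0] AU BU AB0]]] :=
  disjoint_open_subsets X_hausdorff X_perfect openU U0.
have [n /hitting_times_orbit] := f_TT A B openA A0 openB B0.
have disj z : A z -> B z -> False by move=> Az Bz; rewrite -[False]/(set0 z) -AB0.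
case: (absz n) => [|k] [] [x xin fxin].
- by case: (disj x).
- by case: (disj x).
- by exists k.+1 => //; exists x; [exact: AU | exact: BU].
- by exists k.+1 => //; exists x; [exact: BU | exact: AU].
Qed.

Lemma TT_return_unbounded (U : set X) (m : nat) :
  TT f -> open U -> U !=set0 ->
  exists2 n : nat, m <= n & exists2 x, U x & U (iter n f x).
Proof.
move=> f_TT openU U0; elim: m => [|m [n le_mn [x Ux Ufx]]].
  by have [n _ ret] := TT_return_positive f_TT openU U0; exists n.
have [U' [openU' U'0 U'U fU'U]] :=
  quasi_continuous_shrink f_qc openU openU Ux Ufx.
have [k k_gt0 [y U'y U'fy]] := TT_return_positive f_TT openU' U'0.
exists (n + k); first by rewrite -addn1 leq_add.
by exists y; [exact: U'U | rewrite iterD; exact: fU'U].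
Qed.

Lemma TT_TT_plus : TT f -> TT_plus f.
Proof.
move=> f_TT U V openU U0 openV V0.
have [n /hitting_times_orbit] := f_TT U V openU U0 openV V0.
move: (absz n) => k [orbUV|[x Vx Ufx]].
  by exists (Posz k); apply/hitting_times_plusP.
have [V' [openV' V'0 V'V fV'U]] :=
  quasi_continuous_shrink f_qc openV openU Vx Ufx.
have [r le_kr [y V'y V'fy]] := TT_return_unbounded k f_TT openV' V'0.
exists (Posz (r - k)); apply/hitting_times_plusP.
exists (iter k f y); first exact: fV'U.
by rewrite -iterD subnK//; exact: V'V.
Qed.

Lemma TT_plus_TT : TT_plus f -> TT f.
Proof.
move=> f_TTp U V openU U0 openV V0.
by have [n [hit _]] := f_TTp U V openU U0 openV V0; exists n.
Qed.

Lemma TT_plus_TT_plus_plus : TT_plus f -> TT_plus_plus f.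
Proof.
move=> f_TTp U V openU U0 openV V0; apply: infinite_set_int_unbounded => m.
have [[k /hitting_times_plusP[x Ux Vfx]|k []//]] :=
  f_TTp U V openU U0 openV V0.
have [U' [openU' U'0 U'U fU'V]] :=
  quasi_continuous_shrink f_qc openU openV Ux Vfx.
have [r le_mr [y U'y U'fy]] :=
  TT_return_unbounded m (TT_plus_TT f_TTp) openU' U'0.
exists (k + r); first exact: leq_trans (leq_addl _ _).
apply/hitting_times_plusP; exists y; first exact: U'U.
by rewrite iterD; exact: fU'V.
Qed.

End Recurrence.

Theorem theorem4p1 (X : topologicalType) (f : X -> X)
    (X_two_points : exists x y : X, x <> y)
    (f_qc : quasi_continuous_system f)
    (X_perfect : isolated [set: X] = set0)
    (X_hausdorff : hausdorff_space X) :
  (TT f -> TT_plus f) /\ (TT_plus f -> TT_plus_plus f).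
Proof.
by split; [exact: TT_TT_plus | exact: TT_plus_TT_plus_plus].
Qed.
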